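(* Let $\mathcal M=(U,\mathcal L)$ be a (simple) complex of oriented matroids of VC-dimension $d$, and let $\mathcal T\subseteq\{-1,+1\}^U$ be its set of topes. Then the concept class $\mathcal T$ admits a proper labeled sample compression scheme of size $d$.
   Context: Let $U$ be a finite set. A sign vector is a map $X:U\to\{-1,0,+1\}$; its support is $\underline{X}=\{e\in U:X_e\neq 0\}$ and its zero set is $X^0=U\setminus \underline{X}$. For sign vectors $X,Y$: $\mathrm{Sep}(X,Y)=\{e\in U: X_eY_e=-1\}$; the composition $X\circ Y$ is defined by $(X\circ Y)_e=X_e$ if $X_e\neq 0$ and $(X\circ Y)_e=Y_e$ otherwise; $X\le Y$ means $X_e\in\{0,Y_e\}$ for all $e$ (product order with $0\le -1,+1$). A complex of oriented matroids (COM) is a pair $\mathcal M=(U,\mathcal L)$ with $\mathcal L\subseteq\{-1,0,+1\}^U$ satisfying (FS) $X\circ(-Y)\in\mathcal L$ for all $X,Y\in\mathcal L$, and (SE) for all $X,Y\in\mathcal L$ and $e\in \mathrm{Sep}(X,Y)$ there is $Z\in\mathcal L$ with $Z_e=0$ and $Z_f=(X\circ Y)_f$ for all $f\in U\setminus\mathrm{Sep}(X,Y)$. The COM is simple if for each $e$, $\{X_e:X\in\mathcal L\}=\{-1,0,+1\}$, and for all $e\ne f$ there are $X,Y\in\mathcal L$ with $\{X_eX_f,Y_eY_f\}=\{+1,-1\}$. The topes are the maximal elements of $(\mathcal L,\le)$ (these are $\{\pm1\}$-vectors, identified with subsets of $U$). A set $D\subseteq U$ is shattered by the topes if for every $Z\in\{\pm1\}^D$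 some tope restricts to $Z$ on $D$; the VC-dimension of $\mathcal M$ is the maximum size of a shattered set. For a concept class $\mathcal C\subseteq\{-1,+1\}^U$, the set of realizable samples is $\mathrm{Samp}(\mathcal C)=\{S\in\{-1,0,+1\}^U: S\le C \text{ for some } C\in\mathcal C\}$. A proper labeled sample compression scheme of size $k$ for $\mathcal C$ is a pair of maps $\alpha:\mathrm{Samp}(\mathcal C)\to\{-1,0,+1\}^U$ and $\beta:\mathrm{Im}(\alpha)\to\{-1,+1\}^U$ such that for every $S\in\mathrm{Samp}(\mathcal C)$: $\alpha(S)\le S\le \beta(\alpha(S))$, $|\underline{\alpha(S)}|\le k$, and $\beta(\alpha(S))\in\mathcal C$. *)

(* Defs.v *)
From HB Require Import structures.
From mathcomp Require Import all_boot all_order all_algebra.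

Set Implicit Arguments.
Unset Strict Implicit.
Unset Printing Implicit Defensive.

Import GRing.Theory.
Local Open Scope ring_scope.

(* The signs -1, 0, +1 are the elements of 'F_3: only negation and products   *)
(* of signs are used, and on {-1, 0, +1} these agree with those of 'F_3.      *)
(* The zmodType structure of {ffun U -> 'F_3} makes - X the pointwise         *)
(* negation, and support X is the predicate [pred e | X e != 0].              *)
Notation sign := 'F_3.
Notation signvec U := {ffun U -> sign}.

Section SignVectors.

Variable U : finType.
Implicit Types (X Y Z S T : signvec U) (L C : {set signvec U}) (D : {set U}).

Definition sep X Y : {set U} := [set e | X e * Y e == -1].

Definition scomp X Y : signvec U := [ffun e => if X e != 0 then X e else Y e].

Definition sle X Y : bool := [forall e, X e \in [:: 0; Y e]].

(* Membership in {-1, +1}^U. *)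
Definition full X : bool := [forall e, X e \in [:: -1; 1]].

Definition face_symmetry L : Prop :=
  forall X Y, X \in L -> Y \in L -> scomp X (- Y) \in L.

Definition strong_elimination L : Prop :=
  forall X Y e, X \in L -> Y \in L -> e \in sep X Y ->
  exists Z, [/\ Z \in L, Z e = 0
    & forall f, f \notin sep X Y -> Z f = scomp X Y f].

Definition com L : Prop := face_symmetry L /\ strong_elimination L.

Definition simple_com L : Prop :=
  (forall e, [set (X : signvec U) e | X in L] = [set -1; 0; 1]) /\
  (forall e f, e != f -> exists X Y,
     [/\ X \in L, Y \in L & [set X e * X f; Y e * Y f] = [set 1; -1]]).

Definition topes L : {set signvec U} :=
  [set X in L | [forall Y in L, sle X Y ==> (Y == X)]].

(* An element of {-1, +1}^D is given by a sign vector Z that does not vanish  *)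
(* on D; its values outside D are irrelevant.                                 *)
Definition shattered C D : bool :=
  [forall Z : signvec U, [forall e in D, Z e != 0] ==>
    [exists T in C, [forall e in D, (T : signvec U) e == Z e]]].

Definition vcdim C : nat := \max_(D : {set U} | shattered C D) #|D|.

Definition samples C : {set signvec U} := [set S | [exists T in C, sle S T]].

(* The compressor alpha and the reconstructor beta are total functions, but   *)
(* they are constrained only on samples C and on the image of samples C under *)
(* alpha respectively.                                                        *)
Definition proper_labeled_scheme C (k : nat)
    (alpha beta : signvec U -> signvec U) : Prop :=
  forall S, S \in samples C ->
    [/\ sle (alpha S) S, sle S (beta (alpha S)),
        (#|support (alpha S)| <= k)%N, full (beta (alpha S))
      & beta (alpha S) \in C].

Definition admits_proper_labeled_scheme C (k : nat) : Prop :=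
  exists alpha beta, proper_labeled_scheme C k alpha beta.

End SignVectors.

(* Main.v *)
(** Floyd-Warmuth style induction on the ground set. Fix an element [e], let P
    be its parallel class and K the hyperplane of covectors vanishing at [e].
    Compress the part of a sample S lying off P with a scheme for the deletion
    of P. If the reconstructed covector disagrees with S at some element of P,
    strong elimination between it and a covector above S gives a covector of K
    which still realizes S off P. So S off P can be compressed inside K instead,
    and one element of P in the support of S is recorded in addition: it tells
    the reconstructor to decode in K and which side of the hyperplane to choose.
    This costs nothing, because adding [e] to a set shattered by K gives a set
    shattered by the COM. *)

Require Import Defs.
From mathcomp Require Import all_boot all_order all_algebra.

Set Implicit Arguments.
Unset Strict Implicit.
Unset Printing Implicit Defensive.

Import GRing.Theory.
Local Open Scope ring_scope.

(** * Signs, the order and composition of sign vectors *)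

Lemma signP (x : sign) : [\/ x = 0, x = 1 | x = -1].
Proof.
case: x => [[|[|[|n]]] lt_n3] //.
- by constructor 1; apply: val_inj.
- by constructor 2; apply: val_inj.
- by constructor 3; apply: val_inj.
Qed.

Lemma sign_neq0 (x y : sign) : x != 0 -> y != 0 -> x != y -> x = - y.
Proof. by case: (signP x) => ->; case: (signP y) => ->; rewrite ?opprK. Qed.

Lemma mul_signN1 (x y : sign) : (x * y == -1) = (x != 0) && (y == - x).
Proof. by case: (signP x) => ->; case: (signP y) => ->. Qed.

Section Covectors.

Variable U : finType.
Implicit Types (A S T W X Y Z : signvec U).
Implicit Types (L : {set signvec U}) (V D : {set U}).

Lemma sleP X Y : reflect (forall v, X v != 0 -> Y v = X v) (sle X Y).
Proof.
apply: (iffP forallP) => h v.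
  by move=> X0; move: (h v); rewrite !inE (negPf X0) => /eqP.
by rewrite !inE; case: eqP => //= /eqP /h ->.
Qed.

Lemma sle_trans Y X Z : sle X Y -> sle Y Z -> sle X Z.
Proof.
move=> /sleP xy /sleP yz; apply/sleP => v X0.
by rewrite yz xy.
Qed.

Lemma sle_scomp X Y : sle X (scomp X Y).
Proof. by apply/sleP => v X0; rewrite ffunE X0. Qed.

Lemma scomp_eq0 X Y v : (scomp X Y v == 0) = (X v == 0) && (Y v == 0).
Proof.
by rewrite ffunE; have [->|/negPf->] := eqVneq (X v) 0; rewrite ?eqxx.
Qed.

Lemma mem_sep X Y v : (v \in sep X Y) = (X v != 0) && (Y v == - X v).
Proof. by rewrite inE mul_signN1. Qed.

Definition nonzero_on V X : bool := [forall v in V, X v != 0].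

Lemma nonzero_onP V X : reflect {in V, forall v, X v != 0} (nonzero_on V X).
Proof. exact: forall_inP. Qed.

Lemma nonzero_on_scomp V X Y : nonzero_on V Y -> nonzero_on V (scomp X Y).
Proof.
move=> /nonzero_onP h; apply/nonzero_onP => v /h.
by rewrite scomp_eq0 negb_and orbC => ->.
Qed.

Lemma nonzero_on_opp V X : nonzero_on V (- X) = nonzero_on V X.
Proof. by apply: eq_forallb => v; rewrite ffunE oppr_eq0. Qed.

Definition restrict V X : signvec U := [ffun v => if v \in V then X v else 0].

Lemma restrictE V X v : restrict V X v = if v \in V then X v else 0.
Proof. by rewrite ffunE. Qed.

Lemma sle_restrict V X : sle (restrict V X) X.
Proof. by apply/sleP => v; rewrite restrictE; case: ifP; rewrite ?eqxx. Qed.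

(** * Composition, hyperplanes and parallel classes in a COM *)

Lemma com_scomp L X Y : com L -> X \in L -> Y \in L -> scomp X Y \in L.
Proof.
(* Two uses of face symmetry cancel the negation. *)
move=> [fs _] XL YL; suff <-: scomp X (- scomp X (- Y)) = scomp X Y.
  by apply: (fs _ _ XL); apply: fs.
by apply/ffunP => v; rewrite !ffunE; case: ifP => // ->; rewrite opprK.
Qed.

(** Composition never creates zeros, so composing [X] with a covector nonzero at [v], for each [v]
    in [V] in turn, removes all zeros on [V]. *)
Lemma com_nonzero_on L V X :
    com L -> X \in L -> (forall v, v \in V -> exists2 Y, Y \in L & Y v != 0) ->
  exists2 W, W \in L & nonzero_on V W.
Proof.
move=> cL XL hV.
suff [W WL hW]: exists2 W, W \in L & forall v, v \in enum V -> W v != 0.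
  by exists W => //; apply/nonzero_onP => v vV; apply: hW; rewrite mem_enum.
have: {subset enum V <= V} by move=> v; rewrite mem_enum.
elim: (enum V) => [|v s IHs] sV; first by exists X.
have [|W WL hW] := IHs; first by move=> u us; apply: sV; rewrite inE us orbT.
have [|Y YL Yv] := hV v; first by apply: sV; rewrite mem_head.
exists (scomp W Y); first exact: com_scomp.
move=> u; rewrite inE scomp_eq0 negb_and => /orP[/eqP->|/hW->//].
by rewrite Yv orbT.
Qed.

Definition hyperplane L (e : U) : {set signvec U} :=
  [set X in L | X e == 0].

Lemma com_hyperplane L e : com L -> com (hyperplane L e).
Proof.
move=> [fs se]; split=> [X Y|X Y f].
  rewrite !inE => /andP[XL Xe] /andP[YL Ye].
  by rewrite fs //= !ffunE Xe /= oppr_eq0.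
rewrite [X \in _]inE [Y \in _]inE => /andP[XL Xe] /andP[YL Ye] XYf.
have [Z [ZL Zf hZ]] := se X Y f XL YL XYf.
exists Z; split=> //; rewrite inE ZL /= hZ ?scomp_eq0 ?Xe //.
by rewrite mem_sep Xe.
Qed.

(** The factor 0 is allowed here; a covector of [L] nonzero on [V] excludes it and leaves 1 and -1,
    that is, parallel up to reorientation. *)
Definition parallels L V (e : U) : {set U} :=
  [set f in V | [exists s : sign, [forall X in L, X f == s * X e]]].

Lemma parallelsP L V e f : f \in parallels L V e ->
  f \in V /\ exists s : sign, {in L, forall X, X f = s * X e}.
Proof.
rewrite inE => /andP[fV /existsP[s /forall_inP hs]]; split=> //.
by exists s => X /hs /eqP.
Qed.

Lemma mem_parallels L V e f (s : sign) :
  f \in V -> {in L, forall X, X f = s * X e} -> f \in parallels L V e.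
Proof.
move=> fV hs; rewrite inE fV; apply/existsP; exists s.
by apply/forall_inP => X /hs ->.
Qed.

(* An element vanishing on the whole (nonempty) hyperplane of e is parallel   *)
(* to e, by strong elimination of e.                                          *)
Lemma hyperplane_nonzero L V e W X v :
    com L -> W \in L -> nonzero_on V W -> e \in V ->
    X \in hyperplane L e -> v \in V :\: parallels L V e ->
  exists2 Y, Y \in hyperplane L e & Y v != 0.
Proof.
move=> cL WL /nonzero_onP Wn eV XK /setDP[vV vP].
have [Y|K0] := pickP (fun Y => (Y \in hyperplane L e) && (Y v != 0)).
  by case/andP; exists Y.
have {}K0 Y : Y \in L -> Y e = 0 -> Y v = 0.
  by move=> YL Ye; move: (K0 Y); rewrite inE YL Ye eqxx /= => /negbFE /eqP.
case/negP: vP; apply: (@mem_parallels _ _ _ _ (W v / W e)) => // Y YL.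
have [We Wv] := (Wn e eV, Wn v vV).
have [/eqP Ye|Ye] := boolP (Y e == 0); first by rewrite Ye mulr0 K0.
move: XK; rewrite inE => /andP[XL /eqP Xe]; have Xv := K0 X XL Xe.
(* [X] vanishes at [e] and [v], so composing it with [W] or [- W] gives these two entries the ratio
   they have in [W], with the sign at [e] opposite to that of [Y]. *)
have [A [AL Ae Av]] :
    exists A, [/\ A \in L, A e = - Y e & A v = W v / W e * A e].
  have [YW|YW] := eqVneq (W e) (- Y e).
    exists (scomp X W); split; first exact: com_scomp.
      by rewrite ffunE Xe eqxx.
    by rewrite !ffunE Xe Xv eqxx /= divfK.
  exists (scomp X (- W)); split; first by apply: cL.1.
    rewrite !ffunE Xe eqxx /=; congr (- _); apply/eqP.
    by rewrite -[Y e]opprK; apply/eqP/sign_neq0 => //; rewrite oppr_eq0.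
  by rewrite !ffunE Xe Xv eqxx /= mulrN divfK.
have Asep : e \in sep Y A by rewrite mem_sep Ye Ae eqxx.
have [Z [ZL Ze hZ]] := cL.2 Y A e YL AL Asep.
have Av0 : A v != 0.
  by rewrite Av Ae !mulf_neq0 ?invr_eq0 ?oppr_eq0.
(* Were [v] not separated, [Z v] would be nonzero along with [A v], yet [Z] vanishes at [e] and
   hence at [v]. So [Y v = - A v], which is the required ratio. *)
have: v \in sep Y A.
  apply: contraT => /hZ; rewrite (K0 Z) // => /esym/eqP.
  by rewrite scomp_eq0 (negPf Av0) andbF.
by rewrite mem_sep => /andP[_]; rewrite Av Ae mulrN eqr_opp => /eqP ->.
Qed.

(** * Shattering by a COM and by its hyperplanes *)

Lemma shattered_cone L W D e :
    com L -> W \in L -> W e != 0 -> shattered (hyperplane L e) D ->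
  shattered L (e |: D).
Proof.
move=> cL WL We /forallP sD; apply/forallP => Z; apply/implyP => /forall_inP Z0.
have /existsP[T] : [exists T in hyperplane L e, [forall v in D, T v == Z v]].
  apply: (implyP (sD Z)); apply/forall_inP => v vD.
  by apply: Z0; rewrite inE vD orbT.
rewrite inE -andbA => /and3P[TL /eqP Te /forall_inP TZ].
(* [T] is zero at [e] and nonzero on [D], so composing it with [W] or [- W] sets the sign at [e] and
   leaves [D] alone. *)
have ZT (Y : signvec U) : Y e = Z e ->
    [forall v in e |: D, scomp T Y v == Z v].
  move=> Ye; apply/forall_inP => v; rewrite !inE.
  have [->|ne /= vD] := eqVneq v e; first by rewrite ffunE Te eqxx Ye eqxx.
  by rewrite ffunE (eqP (TZ v vD)) Z0 // inE vD orbT.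
have [WZ|WZ] := eqVneq (Z e) (W e).
  apply/existsP; exists (scomp T W).
  by rewrite com_scomp //= ZT.
apply/existsP; exists (scomp T (- W)); rewrite cL.1 //= ZT // ffunE.
by rewrite [RHS](@sign_neq0 _ (W e)) // Z0 // !inE eqxx.
Qed.

(** Testing one constant pattern shows that a shattering class is nonempty, even for empty [D], and
    that no element of [D] is constantly zero. *)
Lemma shattered_all1 L D :
  shattered L D -> exists2 T, T \in L & {in D, forall v, T v = 1}.
Proof.
move=> /forallP/(_ [ffun=> 1])/implyP sD.
have /existsP[T /andP[TL /forall_inP T1]] :
    [exists T in L, [forall v in D, T v == [ffun=> 1] v]].
  by apply: sD; apply/forall_inP => v _; rewrite ffunE.
by exists T => // v /T1 /eqP; rewrite ffunE.
Qed.

Lemma shattered_cone_notin L e D : shattered (hyperplane L e) D -> e \notin D.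
Proof.
move=> /shattered_all1[T]; rewrite inE => /andP[_ /eqP Te] T1.
by apply/negP => /T1; rewrite Te => /eqP.
Qed.

(** * Compression schemes relative to a subset of the ground set *)

Definition realizable L S : Prop := exists2 T, T \in L & sle S T.

(* Relative version of [proper_labeled_scheme]: samples live on V only, and   *)
(* reconstructed covectors are sign vectors that may vanish off V.            *)
Definition scheme_on L V (k : nat) (alpha beta : signvec U -> signvec U) :=
  forall S, (forall v, S v != 0 -> v \in V) -> realizable L S ->
    [/\ sle (alpha S) S, sle S (beta (alpha S)),
        (#|support (alpha S)| <= k)%N, nonzero_on V (beta (alpha S))
      & beta (alpha S) \in L].

Section Combine.

Variables (L : {set signvec U}) (V : {set U}) (k : nat) (e : U) (W : signvec U).
Hypotheses (cL : com L) (WL : W \in L) (Wn : nonzero_on V W) (eV : e \in V).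

Let P := parallels L V e.
Let V' := V :\: P.
Let K := hyperplane L e.

Variables a1 b1 a2 b2 : signvec U -> signvec U.
Hypotheses (h1 : scheme_on L V' k a1 b1) (h2 : scheme_on K V' k.-1 a2 b2).
Hypothesis k_gt0 : forall X, X \in K -> (0 < k)%N.

(** A nonzero entry on [P] is the flag that tells the two decoders apart, since the compressed
    restrictions to [V'] vanish there. On realizable samples the last branch is never reached: a
    failing first test fails at an element of [P]. *)
Definition combined_alpha S : signvec U :=
  let A := a1 (restrict V' S) in
  if sle S (scomp (b1 A) W) then A
  else if [pick f in P | S f != 0] is Some f then
    [ffun v => if v == f then S f else a2 (restrict V' S) v]
  else A.

Definition combined_beta A : signvec U :=
  if [pick f in P | A f != 0] is Some f then
    let T := b2 (restrict V' A) in
    scomp T (if W f == A f then W else - W)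
  else scomp (b1 A) W.

Let notin_V' v : v \in P -> v \notin V'.
Proof. by rewrite in_setD => ->. Qed.

Let inP v : v \in V -> v \notin V' -> v \in P.
Proof. by rewrite in_setD => ->; rewrite andbT negbK. Qed.

(** Entries on [P] are multiples of the one at [e], and the factor at [f] is nonzero because [W f]
    is, so the entry at [f] determines the one at [e]. *)
Let parallel_eq X Y f v : X \in L -> Y \in L -> f \in P -> v \in P ->
  X f = Y f -> X v = Y v.
Proof.
move=> XL YL /parallelsP[fV [s hs]] /parallelsP[_ [t ht]].
rewrite hs // hs // ht // ht // => /mulfI -> //.
by apply: contraNneq (nonzero_onP _ _ Wn f fV) => s0; rewrite hs // s0 mul0r.
Qed.

Let parallel_hyperplane X v : X \in L -> v \in P -> (X v == 0) = (X e == 0).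
Proof.
move=> XL /parallelsP[vV [s hs]]; rewrite hs // mulf_eq0.
suff /negPf-> : s != 0 by [].
by apply: contraNneq (nonzero_onP _ _ Wn v vV) => s0; rewrite hs // s0 mul0r.
Qed.

Let sle_off_P A S v : sle A (restrict V' S) -> v \notin V' -> A v = 0.
Proof.
move=> /sleP h /negPf vV'; apply/eqP; apply: contraT => /[dup] A0 /h.
by rewrite restrictE vV' => A0'; rewrite -A0' eqxx in A0.
Qed.

Lemma scheme_combine : scheme_on L V k combined_alpha combined_beta.
Proof.
move=> S SV [T0 T0L ST0]; set S' := restrict V' S.
have S'V v : S' v != 0 -> v \in V'.
  by rewrite restrictE; case: ifP; rewrite ?eqxx.
have S'S : sle S' S := sle_restrict V' S.
have S'v v : v \in V' -> S' v = S v by move=> h; rewrite restrictE h.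
have [|A1S' S'B1 A1k B1n B1L] := h1 S'V.
  by exists T0 => //; exact: sle_trans ST0.
rewrite /combined_alpha -/S'; set T1 := scomp (b1 (a1 S')) W.
have T1L : T1 \in L by exact: com_scomp.
have T1n : nonzero_on V T1 by exact: nonzero_on_scomp.
have S'T1 : sle S' T1 by apply: sle_trans S'B1 _; exact: sle_scomp.
case: ifP => [ST1|/negbT ST1].
  have -> : combined_beta (a1 S') = T1.
    rewrite /combined_beta; case: pickP => // f /andP[fP].
    by rewrite (sle_off_P A1S') ?eqxx ?notin_V'.
  by split=> //; exact: sle_trans S'S.
have [f0 /andP[Sf0 T1f0]] : exists f, (S f != 0) && (T1 f != S f).
  apply/existsP; apply: contraNT ST1; rewrite negb_exists => /forallP h.
  by apply/sleP => v Sv; apply/eqP; move: (h v); rewrite Sv /= negbK.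
have f0V := SV _ Sf0.
have f0P : f0 \in P.
  apply: inP => //; apply: contraNN T1f0 => f0V'; apply/eqP.
  by rewrite -S'v //; apply: (sleP _ _ S'T1); rewrite S'v.
case: pickP => [f /andP[fP Sf]|/(_ f0)]; last by rewrite f0P Sf0.
(* Eliminate [f0] between [T0] and [T1]: both agree with [S'] on its support, so [Z] does too;
   vanishing at [f0] in [P] forces vanishing at [e]. *)
have [Z ZK S'Z] : realizable K S'.
  have f0sep : f0 \in sep T0 T1.
    rewrite mem_sep (sleP _ _ ST0) // Sf0 /=; apply/eqP; apply: sign_neq0 => //.
    exact: (nonzero_onP _ _ T1n).
  have [Z [ZL Zf0 hZ]] := cL.2 T0 T1 f0 T0L T1L f0sep.
  exists Z; first by rewrite inE ZL -(parallel_hyperplane ZL f0P) Zf0 eqxx.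
  apply/sleP => v S'v0; have Sv := S'v v (S'V v S'v0).
  have T0v : T0 v = S' v by rewrite Sv; apply: (sleP _ _ ST0); rewrite -Sv.
  have T1v : T1 v = S' v := sleP _ _ S'T1 v S'v0.
  rewrite hZ; first by rewrite ffunE T0v S'v0.
  by rewrite mem_sep T0v T1v; case: (signP (S' v)) S'v0 => ->.
have [|A2S' S'B2 A2k B2n] := h2 S'V; first by exists Z.
rewrite inE => /andP[B2L B2e].
set A := [ffun v => _].
have Av v : A v = if v == f then S f else a2 S' v by rewrite ffunE.
have restrA : restrict V' A = a2 S'.
  apply/ffunP => v; rewrite restrictE Av; case: ifP => [vV'|/negbT vV'].
    by case: eqP vV' => // ->; rewrite (negPf (notin_V' fP)).
  by rewrite (sle_off_P A2S').
have AS : sle A S.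
  apply/sleP => v; rewrite Av; have [-> //|_] := eqVneq v f => A0.
  by apply: (sleP _ _ (sle_trans A2S' S'S)).
have -> : combined_beta A = scomp (b2 (a2 S')) (if W f == S f then W else - W).
  rewrite /combined_beta; case: pickP => [g /andP[gP]|/(_ f)]; last first.
    by rewrite fP Av eqxx Sf.
  rewrite restrA !Av; have [->//|_] := eqVneq g f.
  by rewrite (sle_off_P A2S') ?eqxx ?notin_V'.
set W' := if _ then _ else _; set R := scomp _ _.
have Wf : W f != 0 by apply: (nonzero_onP _ _ Wn); apply: SV.
have RL : R \in L.
  by rewrite /R /W'; case: ifP => _; [exact: com_scomp | exact: cL.1].
have Rf : R f = S f.
  have B2f : b2 (a2 S') f == 0 by rewrite (parallel_hyperplane B2L fP).
  rewrite /R ffunE B2f /= /W'; case: eqP => // /eqP WS.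
  by rewrite ffunE [RHS](@sign_neq0 _ (W f)) // eq_sym.
split=> //.
- apply/sleP => v Sv; have [vV'|vV'] := boolP (v \in V').
    have S'v0 : S' v != 0 by rewrite S'v.
    by rewrite -S'v //; apply: (sleP _ _ (sle_trans S'B2 (sle_scomp _ _))).
  (* On [P], agreement of [R] and [T0] at [f] spreads to the whole class. *)
  rewrite -(sleP _ _ ST0 v Sv); apply: (parallel_eq RL T0L fP).
    by apply: inP => //; apply: SV.
  by rewrite Rf (sleP _ _ ST0 f Sf).
- have <- : (1 + k.-1)%N = k by rewrite add1n prednK // (k_gt0 ZK).
  apply: (@leq_trans #|[predU1 f & support (a2 S')]|).
    apply/subset_leq_card/subsetP => v; rewrite !inE Av.
    by have [->|] := eqVneq v f.
  by rewrite cardU1 leq_add ?leq_b1.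
- apply: nonzero_on_scomp.
  by rewrite /W'; case: ifP => _; rewrite ?nonzero_on_opp.
Qed.

End Combine.

Lemma scheme_on_set0 L k : exists alpha beta, scheme_on L set0 k alpha beta.
Proof.
have [X XL|L0] := pickP [in L]; last first.
  by exists id, id => S _ [T TL]; rewrite L0 in TL.
exists (fun _ => 0), (fun _ => X) => S SV _.
have S0 v : (S v != 0) = false.
  by apply/negbTE/negP => Sv; have := SV v Sv; rewrite inE.
split=> //; first by apply/sleP => v; rewrite ffunE eqxx.
- by apply/sleP => v; rewrite S0.
- by rewrite eq_card0 // => v; rewrite inE ffunE eqxx.
- by apply/nonzero_onP => v; rewrite inE.
Qed.

(** Deletion is modelled by shrinking [V] while [L] stays on [U], so one induction on the size of
    [V], general in [L] and [k], serves both deletion and hyperplane. The nonvanishing hypothesis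
    presupposes some [X] in [L] because a hyperplane may be empty. *)
Lemma com_scheme_on L V k :
    com L ->
    (forall X v, X \in L -> v \in V -> exists2 Y, Y \in L & Y v != 0) ->
    (forall D, D \subset V -> shattered L D -> #|D| <= k)%N ->
  exists alpha beta, scheme_on L V k alpha beta.
Proof.
have [n] := ubnP #|V|; elim: n => // n IHn in L V k * => Vn cL hV hk.
have [->|/set0Pn[e eV]] := eqVneq V set0; first exact: scheme_on_set0.
have [X XL|L0] := pickP [in L]; last first.
  by exists id, id => S _ [T TL]; rewrite L0 in TL.
have [W WL Wn] := com_nonzero_on cL XL (fun v => hV X v XL).
have We := nonzero_onP _ _ Wn e eV.
set V' := V :\: parallels L V e.
have V'V : V' \subset V by exact: subsetDl.
have V'n : (#|V'| < n)%N.
  rewrite -ltnS; apply: leq_trans Vn; rewrite ltnS.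
  apply/proper_card/properP; split=> //; exists e => //.
  by rewrite inE (@mem_parallels _ _ _ _ 1) // => Y _; rewrite mul1r.
have hK D : D \subset V -> shattered (hyperplane L e) D -> (#|D| < k)%N.
  move=> DV sD; have := hk (e |: D); rewrite cardsU1 (shattered_cone_notin sD).
  by apply; [rewrite subUset sub1set eV DV | exact: (shattered_cone cL WL We)].
have [||a1 [b1 h1]] := IHn L V' k V'n cL.
- by move=> Y v YL /(subsetP V'V); apply: hV YL.
- by move=> D DV'; apply: hk; apply: subset_trans V'V.
have [||a2 [b2 h2]] := IHn _ V' k.-1 V'n (com_hyperplane e cL).
- by move=> Y v; apply: (hyperplane_nonzero cL WL Wn eV).
- by move=> D DV' sD; have := hK D (subset_trans DV' V'V) sD; case: (k).
exists (combined_alpha L V e W a1 b1 a2), (combined_beta L V e W b1 b2).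
apply: (scheme_combine cL WL Wn h1 h2) => Y YK.
(* A nonempty hyperplane shatters the empty set, so [hK] gives [0 < k] and [k.-1] is a true
   predecessor. *)
suff /hK: shattered (hyperplane L e) set0 by rewrite cards0 sub0set; apply.
apply/forallP => Z; apply/implyP => _; apply/existsP; exists Y; rewrite YK.
by apply/forall_inP => v; rewrite inE.
Qed.

(** * From covectors to topes *)

Lemma nonzero_tope L X : X \in L -> nonzero_on setT X -> X \in topes L.
Proof.
move=> XL /nonzero_onP Xn; rewrite inE XL; apply/forall_inP => Y YL.
by apply/implyP => /sleP h; apply/eqP/ffunP => v; apply: h; apply: Xn.
Qed.

Lemma nonzero_full X : nonzero_on setT X -> full X.
Proof.
move=> /nonzero_onP h; apply/forallP => v; have := h v (in_setT v).
by case: (signP (X v)) => ->.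
Qed.

(** The dimension is measured on topes, the induction on covectors; composing with [W] fills the
    zeros of a covector and keeps its pattern on [D]. *)
Lemma shattered_topes L W D :
    com L -> W \in L -> nonzero_on setT W -> shattered L D ->
  shattered (topes L) D.
Proof.
move=> cL WL Wn /forallP sD; apply/forallP => Z; apply/implyP => hZ.
have /existsP[T /andP[TL /forall_inP TZ]] := implyP (sD Z) hZ.
apply/existsP; exists (scomp T W).
rewrite nonzero_tope ?com_scomp ?nonzero_on_scomp //=.
apply/forall_inP => v vD; rewrite ffunE (eqP (TZ v vD)).
by rewrite (forall_inP hZ).
Qed.

End Covectors.

Theorem theorem29 (U : finType) (L : {set signvec U}) (d : nat)
    (comL : com L) (simpleL : simple_com L) (vcL : vcdim (topes L) = d) :
  admits_proper_labeled_scheme (topes L) d.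
Proof.
have hL X v :
    X \in L -> v \in setT -> exists2 Y : signvec U, Y \in L & Y v != 0.
  move=> _ _; have: 1 \in [set (Y : signvec U) v | Y in L].
    by rewrite simpleL.1 !inE eqxx orbT.
  by case/imsetP => Y YL Yv; exists Y; rewrite // -Yv.
have [|alpha [beta h]] := com_scheme_on (k := d) comL hL.
  move=> D _ sD; have [T TL _] := shattered_all1 sD.
  have [W WL Wn] := com_nonzero_on comL TL (fun v => hL T v TL).
  by rewrite -vcL; apply: leq_bigmax_cond; exact: (shattered_topes comL WL Wn).
exists alpha, beta => S; rewrite inE => /existsP[T /andP[]].
rewrite inE => /andP[TL _] ST.
have [v _||? ? ? n ?] := @h S; [by rewrite in_setT | by exists T |].
by split=> //; [exact: nonzero_full | exact: nonzero_tope].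
Qed.
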